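(* Let $B=[b_{ij}]$ be an $r\times n$ integer matrix and $c=(c_1,\dots,c_r)$ an integer vector, and let $\mathcal S$ be the Diophantine system $Bp=c$ in nonnegative integer unknowns $p=(p_1,\dots,p_n)$, with complete generating function $F_{\mathcal S}(x_1,\dots,x_n)=\sum_{p\in\mathcal S}x_1^{p_1}\cdots x_n^{p_n}$ (sum over nonnegative integer solutions). Let $\mathcal{SS}$ be the system in nonnegative integer unknowns $p=(p_1,\dots,p_{2n})$ given by $[B\,|\,B]\,p=c'$, where $[B\,|\,B]$ is the $r\times 2n$ matrix obtained by placing two copies of $B$ side by side and $c'_i=c_i-b_{i1}-b_{i2}-\cdots-b_{in}$ for $i=1,\dots,r$. Then the complete generating function of $\mathcal{SS}$ is $$F_{\mathcal{SS}}(x_1,\dots,x_{2n})=\delta_{1,n+1}\delta_{2,n+2}\cdots\delta_{n,2n}F_{\mathcal S}(x_1,\dots,x_n).$$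
   Context: For indices $i\ne j$, the divided difference operator $\delta_{i,j}$ acts on a function $f(x)$ by $\delta_{i,j}f(x)=\dfrac{f(x)-f(x)|_{x_i\leftrightarrow x_j}}{x_i-x_j}$, where $f(x)|_{x_i\leftrightarrow x_j}$ denotes $f$ with the variables $x_i$ and $x_j$ interchanged. *)

(* Defs.v *)
From Stdlib Require Import ClassicalEpsilon FunctionalExtensionality.
From mathcomp Require Import all_boot all_order all_fingroup all_algebra.
From mathcomp Require Import zify.
From mathcomp.multinomials Require Import mpoly.

Set Implicit Arguments.
Unset Strict Implicit.
Unset Printing Implicit Defensive.

Import GRing.Theory.
Local Open Scope ring_scope.

(* Formal power series in m variables over R, given by their coefficients. *)
Definition mpseries (R : comNzRingType) (m : nat) := 'X_{1..m} -> R.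

Section PowerSeries.
Variables (R : comNzRingType) (m : nat).
Implicit Types (f g h : mpseries R m) (a : 'X_{1..m}) (i j : 'I_m).

Definition psX i : mpseries R m := fun a => (a == U_(i)%MM)%:R.

Definition pssub f g : mpseries R m := fun a => f a - g a.

(* Cauchy product; the bound on the degree of b, implied by b <= a, only makes
   the index type finite. *)
Definition psmul f g : mpseries R m :=
  fun a => \sum_(b : 'X_{1..m < (mdeg a).+1} | (b <= a)%MM) f b * g (a - b)%MM.

(* f with the variables x_i and x_j interchanged. *)
Definition psswap i j f : mpseries R m :=
  fun a => f [multinom a (tperm i j k) | k < m].

(* A series g with d * g = f, when there is one. *)
Definition psdiv f d : mpseries R m :=
  epsilon (inhabits (fun=> 0)) (fun g => psmul d g = f).

Definition divided_diff i j f : mpseries R m :=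
  psdiv (pssub f (psswap i j f)) (pssub (psX i) (psX j)).

(* For i != j the quotient defining divided_diff exists and is unique, see
   divided_diffP and divided_diff_uniq. *)

Lemma psmulXE i g a :
  psmul (psX i) g a = if (U_(i) <= a)%MM then g (a - U_(i))%MM else 0.
Proof.
rewrite /psmul /psX; case: ifPn => [le_ia | nle_ia].
  have ltd : (mdeg U_(i) < (mdeg a).+1)%N.
    by rewrite ltnS -(submK le_ia) mdegD leq_addl.
  rewrite (bigD1 (BMultinom ltd)) //= eqxx mul1r big1 ?addr0 // => b.
  case/andP=> _ neb; case: eqP => [eb|_]; last by rewrite mul0r.
  by case/eqP: neb; apply: val_inj.
rewrite big1 // => b le_ba; case: eqP => [eb|_]; last by rewrite mul0r.
by rewrite -eb le_ba in nle_ia.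
Qed.

Lemma psmul_subXE i j g a :
  psmul (pssub (psX i) (psX j)) g a =
    (if (U_(i) <= a)%MM then g (a - U_(i))%MM else 0)
    - (if (U_(j) <= a)%MM then g (a - U_(j))%MM else 0).
Proof.
rewrite -!psmulXE /psmul /pssub -sumrB.
by apply: eq_bigr => b _; rewrite mulrBl.
Qed.

Lemma le_mnm1 i a : (U_(i) <= a)%MM = (0 < a i)%N.
Proof.
apply/mnm_lepP/idP => [/(_ i)|ai k]; first by rewrite mnm1E eqxx.
by rewrite mnm1E; case: eqP => [<-|].
Qed.

Lemma psmul_subX_inj i j g h : i != j ->
  psmul (pssub (psX i) (psX j)) g = psmul (pssub (psX i) (psX j)) h -> g = h.
Proof.
move=> neij egh; apply: functional_extensionality => a.
have [n le_an] := ubnP (a i); elim: n a le_an => // n IHn a le_an.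
have := congr1 (fun s => s (a + U_(j))%MM) egh.
rewrite !psmul_subXE !le_mnm1 !mnmDE !mnm1E eqxx addn1 /= addmK.
rewrite eq_sym (negPf neij) addn0; case: ifP => [ai_gt0|_].
  rewrite IHn => [/addrI /oppr_inj //|].
  by rewrite mnmBE mnmDE !mnm1E eqxx eq_sym (negPf neij); lia.
by move/addrI/oppr_inj.
Qed.

Let upd i j a p q : 'X_{1..m} :=
  [multinom (if k == i then p else if k == j then q else a k) | k < m].

Lemma divided_diff_ex i j f : i != j ->
  exists g, psmul (pssub (psX i) (psX j)) g = pssub f (psswap i j f).
Proof.
move=> neij; set h := pssub f _.
have neji : j != i by rewrite eq_sym.
pose S a N n := \sum_(l < n) h (upd i j a l (N - l)).
exists (fun a => - S a (a i + a j).+1 (a i).+1).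
apply: functional_extensionality => a.
have updB a' p q : (forall k, k != i -> k != j -> a' k = a k) ->
    upd i j a' p q = upd i j a p q.
  move=> eqa; apply/mnmP => k; rewrite !mnmE.
  by case: (eqVneq k i) => // neki; case: (eqVneq k j) => // nekj; apply: eqa.
have SB k a' N n : (k == i) || (k == j) -> a' = (a - U_(k))%MM ->
    S a' N n = S a N n.
  move=> ek ->; apply: eq_bigr => l _; rewrite updB // => k' ni nj.
  rewrite mnmBE mnm1E; case: eqP => [e|]; last by rewrite subn0.
  by move: ek; rewrite e (negPf ni) (negPf nj).
rewrite psmul_subXE !le_mnm1.
have -> : (if (0 < a i)%N then
    - S (a - U_(i))%MM (((a - U_(i))%MM i + (a - U_(i))%MM j).+1)
        ((a - U_(i))%MM i).+1 else 0) = - S a (a i + a j)%N (a i).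
  rewrite !mnmBE !mnm1E eqxx (negPf neij) subn0.
  case: ifPn => [gt0|]; last first.
    by rewrite -eqn0Ngt => /eqP ->; rewrite /S big_ord0 oppr0.
  rewrite (SB i) ?eqxx //; congr (- S _ _ _); lia.
have -> : (if (0 < a j)%N then
    - S (a - U_(j))%MM (((a - U_(j))%MM i + (a - U_(j))%MM j).+1)
        ((a - U_(j))%MM i).+1 else 0) = - S a (a i + a j)%N (a i).+1.
  rewrite !mnmBE !mnm1E eqxx (negPf neji) subn0.
  case: ifPn => [gt0|]; first by
    rewrite (SB j) ?eqxx ?orbT //; congr (- S _ _ _); lia.
  rewrite -eqn0Ngt => /eqP ->; rewrite addn0 /S /h /pssub sumrB.
  rewrite [X in X - _](reindex_inj rev_ord_inj) /=.
  rewrite (eq_bigr (fun l : 'I_(a i).+1 =>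
    psswap i j f (upd i j a l (a i - l)))) ?subrr ?oppr0 // => l _.
  rewrite /psswap; congr f; apply/mnmP => k.
  rewrite !mnmE; case: (eqVneq k i) => [->|nki].
    by rewrite tpermL (negPf neji) eqxx subSS.
  case: (eqVneq k j) => [->|nkj]; first by
    rewrite tpermR eqxx; have := ltn_ord l; lia.
  by rewrite tpermD ?(negPf nki) ?(negPf nkj) // eq_sym.
rewrite opprK /S big_ord_recr /= addrA addNr add0r; congr h.
by apply/mnmP => k; rewrite mnmE; case: eqP => [->//|_]; case: eqP => [->|//];
  rewrite addKn.
Qed.

Lemma divided_diffP i j f : i != j ->
  psmul (pssub (psX i) (psX j)) (divided_diff i j f) = pssub f (psswap i j f).
Proof.
by move=> neij; apply: (epsilon_spec _ (fun g => psmul _ g = _));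
  apply: divided_diff_ex.
Qed.

Lemma divided_diff_uniq i j f g : i != j ->
  psmul (pssub (psX i) (psX j)) g = pssub f (psswap i j f) ->
  g = divided_diff i j f.
Proof.
by move=> neij eg; apply: (psmul_subX_inj neij); rewrite eg divided_diffP.
Qed.

End PowerSeries.

(* A series in x_1, ..., x_n regarded as a series in x_1, ..., x_(n + k). *)
Definition pswiden (R : comNzRingType) (n k : nat) (f : mpseries R n) :
    mpseries R (n + k) :=
  fun a => if [forall j : 'I_k, a (rshift n j) == 0%N]
           then f [multinom a (lshift k j) | j < n] else 0.
Arguments pswiden {R n} k f.

Definition is_solution (r n : nat) (B : 'M[int]_(r, n)) (c : 'cV[int]_r)
    (p : 'X_{1..n}) : bool :=
  B *m (\col_j (p j)%:Z) == c.

(* The sum of x^p over the solutions p: the coefficient of x^p is 1 if p is a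
   solution and 0 otherwise. *)
Definition complete_gf (R : comNzRingType) (r n : nat) (B : 'M[int]_(r, n))
    (c : 'cV[int]_r) : mpseries R n :=
  fun p => (is_solution B c p)%:R.
Arguments complete_gf R {r n} B c.

(* delta_{1,n+1} (delta_{2,n+2} (... (delta_{n,2n} f))) *)
Definition divided_diffs (R : comNzRingType) (n : nat)
    (f : mpseries R (n + n)) : mpseries R (n + n) :=
  foldr (fun i : 'I_n => divided_diff (lshift n i) (rshift n i)) f (enum 'I_n).

(* Main.v *)
Require Import Defs.
From Stdlib Require Import FunctionalExtensionality.
From mathcomp Require Import all_boot all_order all_fingroup all_algebra.
From mathcomp Require Import zify.
From mathcomp.multinomials Require Import mpoly.

Import GRing.Theory.
Local Open Scope ring_scope.

(** Since delta_{x,y} x^m is the sum of x^p y^q over p + q + 1 = m, applying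
    delta_{j,n+j} for the indices j in a set s to a series f in x_1, ..., x_n
    gives the series whose coefficient at (p, q) is that of f at the exponent
    with entries p_j + q_j + [j in s], provided that q_j = 0 for j outside s, and
    is 0 otherwise.  For s = {1, ..., n} this turns the equation B p = c into
    B (p + q + 1) = c. *)

Section MergedSeries.
Variables (R : comNzRingType) (n : nat).
Implicit Types (s : seq 'I_n) (a : 'X_{1..n + n}) (f : mpseries R n).

Definition merge_exp s a : 'X_{1..n} :=
  [multinom (a (lshift n j) + a (rshift n j) + (j \in s))%N | j < n].

Definition supp_in s a : bool :=
  [forall j : 'I_n, (j \notin s) ==> (a (rshift n j) == 0%N)].

Definition merged_series s f : mpseries R (n + n) :=
  fun a => if supp_in s a then f (merge_exp s a) else 0.

Lemma merged_series_nil f : merged_series [::] f = pswiden n f.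
Proof.
apply: functional_extensionality => a; rewrite /merged_series /pswiden.
have -> : supp_in [::] a = [forall j : 'I_n, a (rshift n j) == 0%N].
  by apply: eq_forallb => j; rewrite in_nil.
case: ifP => // /forallP a0; congr f; apply/mnmP => j.
by rewrite !mnmE (eqP (a0 j)) in_nil !addn0.
Qed.

(** Splits off the only constraint lost when [i] joins [s], so that both support conditions can be
    compared through the weaker one. *)
Lemma supp_in_cons s i a : i \notin s ->
  supp_in s a = supp_in (i :: s) a && (a (rshift n i) == 0%N).
Proof.
move=> nis; apply/forallP/andP => [sa|[/forallP sa ai] j].
  split; last exact: (implyP (sa i)).
  apply/forallP => j; apply/implyP; rewrite inE negb_or => /andP[_].
  exact: (implyP (sa j)).
apply/implyP => njs; case: (eqVneq j i) => [->//|neji].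
by apply: (implyP (sa j)); rewrite inE negb_or neji.
Qed.

Lemma eq_supp_in s a a' :
  (forall j, j \notin s -> a (rshift n j) = a' (rshift n j)) ->
  supp_in s a = supp_in s a'.
Proof.
move=> eqa; apply: eq_forallb => j.
by case: (boolP (j \in s)) => //= njs; rewrite eqa.
Qed.

(** Quotients by [x_i - x_(n+i)] are unique, so it suffices to multiply by this difference and
    compare coefficients at each [a]; all four terms involve one value [C], that of [f] at
    [merge_exp s a], or 0 off the support of [i :: s]. *)
Lemma merged_series_cons s i f : i \notin s ->
  merged_series (i :: s) f =
  divided_diff (lshift n i) (rshift n i) (merged_series s f).
Proof.
move=> nis; apply: divided_diff_uniq; first by rewrite eq_lrshift.
apply: functional_extensionality => a.
rewrite psmul_subXE !le_mnm1 /pssub /psswap.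
(* Removing a unit from either variable of the pair cancels the extra 1 that [i] contributes in
   [i :: s], so both predecessors of [a] have coefficient [C]. *)
have predE (k : 'I_(n + n)) : (k == lshift n i) || (k == rshift n i) ->
    (0 < a k)%N -> merged_series (i :: s) f (a - U_(k))%MM =
    if supp_in (i :: s) a then f (merge_exp s a) else 0.
  move=> ek ak; rewrite /merged_series.
  have -> : supp_in (i :: s) (a - U_(k))%MM = supp_in (i :: s) a.
    apply: eq_supp_in => j; rewrite inE negb_or => /andP[neji _].
    rewrite mnmBE mnm1E; case/orP: ek => /eqP ->.
      by rewrite eq_lrshift subn0.
    by rewrite eq_rshift eq_sym (negPf neji) subn0.
  case: ifP => // _; congr f; apply/mnmP => j.
  rewrite !mnmE inE; case: (eqVneq j i) => [->|neji] /=.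
    rewrite (negPf nis).
    by case/orP: ek ak => /eqP ->; rewrite eqxx ?eq_lrshift ?eq_rlshift; lia.
  by case/orP: ek ak => /eqP -> _;
    rewrite ?eq_lrshift ?eq_rlshift ?eq_lshift ?eq_rshift eq_sym (negPf neji) !subn0.
(* The merged exponent is symmetric in the pair; the swap only moves the vanishing condition to the
   left variable. *)
have swapE : merged_series s f
    [multinom a (tperm (lshift n i) (rshift n i) k) | k < n + n] =
    if supp_in (i :: s) a && (a (lshift n i) == 0%N)
    then f (merge_exp s a) else 0.
  rewrite /merged_series (supp_in_cons s i) // mnmE tpermR.
  rewrite (eq_supp_in (i :: s) _ a) => [|j].
    case: ifP => // _; congr f; apply/mnmP => j; rewrite !mnmE.
    case: (eqVneq j i) => [->|neji].
      by rewrite tpermL tpermR [X in (X + _)%N]addnC.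
    by rewrite !tpermD ?eq_lrshift ?eq_rlshift ?eq_lshift ?eq_rshift // eq_sym.
  rewrite inE negb_or mnmE => /andP[neji _].
  by rewrite tpermD ?eq_lrshift ?eq_rshift // eq_sym.
have -> : merged_series s f a =
    if supp_in (i :: s) a && (a (rshift n i) == 0%N)
    then f (merge_exp s a) else 0.
  by rewrite /merged_series (supp_in_cons s i).
rewrite swapE.
(* With [p], [q] the two exponents, what remains is [[p > 0] C - [q > 0] C = [q = 0] C - [p = 0]
   C]. *)
have [al|al] := posnP (a (lshift n i)); have [ar|ar] := posnP (a (rshift n i));
  by rewrite ?(predE (lshift n i)) ?(predE (rshift n i)) ?eqxx ?orbT
    ?andbT ?andbF ?subrr.
Qed.

Lemma divided_diffs_pswiden f :
  divided_diffs (pswiden n f) = merged_series (enum 'I_n) f.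
Proof.
rewrite /divided_diffs -merged_series_nil.
(* Duplicate-freeness of the enumeration gives [i \notin s] at each step. *)
elim: (enum _) (enum_uniq 'I_n) => //= i s IHs /andP[nis us].
by rewrite IHs // merged_series_cons.
Qed.

Lemma divided_diffs_pswidenE f a :
  divided_diffs (pswiden n f) a =
  f [multinom (a (lshift n j) + a (rshift n j) + 1)%N | j < n].
Proof.
rewrite divided_diffs_pswiden /merged_series ifT.
  by congr f; apply/mnmP => j; rewrite !mnmE mem_enum.
by apply/forallP => j; rewrite mem_enum.
Qed.

End MergedSeries.

(** The row sums of [B] form [B] times the all-ones vector, so [B u + B v = c - B 1] is
    [B (u + v + 1) = c]. *)
Lemma is_solution_row_mx (r n : nat) (B : 'M[int]_(r, n)) (c : 'cV[int]_r)
    (a : 'X_{1..n + n}) :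
  is_solution (row_mx B B) (\col_i (c i 0 - \sum_(j < n) B i j)) a =
  is_solution B c [multinom (a (lshift n j) + a (rshift n j) + 1)%N | j < n].
Proof.
pose u : 'cV[int]_n := \col_j (a (lshift n j))%:Z.
pose v : 'cV[int]_n := \col_j (a (rshift n j))%:Z.
rewrite /is_solution.
have -> : \col_j (a j)%:Z = col_mx u v.
  by apply/colP => k; rewrite -[k]splitK; case: (split k) => j /=;
    rewrite ?col_mxEu ?col_mxEd !mxE.
have -> : \col_i (c i 0 - \sum_(j < n) B i j) = c - B *m const_mx 1.
  apply/colP => i; rewrite !mxE; congr (_ - _).
  by apply: eq_bigr => j _; rewrite mxE mulr1.
rewrite mul_row_col eq_sym subr_eq eq_sym -!mulmxDr; congr (B *m _ == c).
by apply/colP => j; rewrite !mxE mnmE !PoszD.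
Qed.

Theorem theorem4p1 (R : comNzRingType) (r n : nat)
    (B : 'M[int]_(r, n)) (c : 'cV[int]_r) :
  complete_gf R (row_mx B B) (\col_i (c i 0 - \sum_(j < n) B i j)) =
  divided_diffs (pswiden n (complete_gf R B c)).
Proof.
apply: functional_extensionality => a.
by rewrite divided_diffs_pswidenE /complete_gf is_solution_row_mx.
Qed.
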